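(* Let $G$ be an $n$-vertex finite simple graph with $\alpha(G)=2$. For every positive integer $\ell$ with $\ell<\chi(G)$, the graph $G$ contains a special odd model of the complete bipartite graph $K_{\ell,\chi(G)-\ell}$.
   Context: $\alpha(G)$ is the independence number and $\chi(G)$ the chromatic number of $G$. For a graph $H$, an $H$-model in $G$ is a collection $(T_v)_{v\in V(H)}$ of pairwise vertex-disjoint subgraphs of $G$, each a tree (branch sets), such that for every edge $uv\in E(H)$ some edge of $G$ joins $T_u$ and $T_v$. An $H$-model is odd if there is a $2$-colouring of the vertices of the branch sets such that every edge inside each tree $T_v$ is bichromatic and, for each $uv\in E(H)$, there is an edge between $T_u$ and $T_v$ whose endpoints have the same colour. An odd $H$-model is special if, for some such $2$-colouring, all branch sets that consist of a single vertex receive the same colour. *)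

(* Defs.v *)
From mathcomp Require Import all_boot.

Set Implicit Arguments.
Unset Strict Implicit.
Unset Printing Implicit Defensive.

Record sgraph := SGraph {
  vert :> finType;
  adj : rel vert;
  adj_sym : symmetric adj;
  adj_irrefl : irreflexive adj
}.

Section Invariants.

Variable G : sgraph.

Definition stable (A : {set G}) : bool :=
  [forall x in A, forall y in A, ~~ adj x y].

Definition independence_number : nat :=
  \max_(A : {set G} | stable A) #|A|.

Definition proper_coloring (k : nat) (f : {ffun G -> 'I_k}) : bool :=
  [forall x, forall y, adj x y ==> (f x != f y)].

Definition colorable (k : nat) : bool :=
  [exists f : {ffun G -> 'I_k}, proper_coloring f].

Lemma colorable_ex : exists k, colorable k.
Proof.
exists #|G|; apply/existsP; exists [ffun x => enum_rank x].
apply/forallP => x; apply/forallP => y; apply/implyP => xy.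
rewrite !ffunE; apply: contraTneq xy => /enum_rank_inj ->.
by rewrite adj_irrefl.
Qed.

Definition chromatic_number : nat := ex_minn colorable_ex.

Record subgraph := Subgraph {
  sverts : {set G};
  sedge : rel G;
  sedge_sym : symmetric sedge;
  sedge_adj : forall x y, sedge x y -> adj x y;
  sedge_verts : forall x y, sedge x y -> (x \in sverts) && (y \in sverts)
}.

(* Cycles are listed by their vertices, so a genuine cycle has at least 3. *)
Definition is_tree (S : subgraph) : Prop :=
  [/\ sverts S != set0,
      {in sverts S &, forall x y, connect (sedge S) x y} &
      forall c : seq G, uniq c -> 2 < size c -> ~~ cycle (sedge S) c].

End Invariants.

Section Models.

Variables H G : sgraph.

Definition is_model (M : H -> subgraph G) : Prop :=
  [/\ forall v, is_tree (M v),
      forall u v, u != v -> [disjoint sverts (M u) & sverts (M v)] &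
      forall u v, adj u v ->
        exists x y, [/\ x \in sverts (M u), y \in sverts (M v) & adj x y]].

(* c is defined on all of G, but only its values on branch sets matter. *)
Definition odd_coloring (M : H -> subgraph G) (c : G -> bool) : Prop :=
  (forall v x y, sedge (M v) x y -> c x != c y) /\
  (forall u v, adj u v ->
     exists x y, [/\ x \in sverts (M u), y \in sverts (M v), adj x y
                   & c x = c y]).

Definition singletons_monochromatic (M : H -> subgraph G) (c : G -> bool) :
    Prop :=
  forall u v x y, sverts (M u) = [set x] -> sverts (M v) = [set y] -> c x = c y.

Definition is_special_odd_model (M : H -> subgraph G) : Prop :=
  is_model M /\ exists c, odd_coloring M c /\ singletons_monochromatic M c.

Definition has_special_odd_model : Prop :=
  exists M : H -> subgraph G, is_special_odd_model M.

End Models.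

Section CompleteBipartite.

Variables a b : nat.

Definition Kab_adj (x y : 'I_a + 'I_b) : bool :=
  match x, y with
  | inl _, inr _ | inr _, inl _ => true
  | _, _ => false
  end.

Lemma Kab_adj_sym : symmetric Kab_adj.
Proof. by case=> ? [] ?. Qed.

Lemma Kab_adj_irrefl : irreflexive Kab_adj.
Proof. by case. Qed.

Definition complete_bipartite : sgraph := SGraph Kab_adj_sym Kab_adj_irrefl.

End CompleteBipartite.

(* Main.v *)
(* Let T be the complement of G; it is triangle-free. A seagull is an induced
   path u - w - v of G; as u and v are nonadjacent, every other vertex is
   adjacent to u or v, so a seagull whose ends are red and whose centre is blue
   is joined by a red-red edge to every branch set containing a red vertex. All
   models below consist of seagulls and of red singletons.

   If |V| >= 2t - 1 and 2l <= t, take the largest k < l such that V contains k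
   disjoint seagulls, a vertex z outside them, and among the packings of k
   seagulls avoiding z one that covers as many T-neighbours of z as possible. Let
   N be the set of uncovered T-neighbours of z. If |N| < t - 2k, the uncovered
   vertices outside N number at least t - k, and they supply the singletons that
   complete the k seagulls to a model. Otherwise every seagull contains a
   T-neighbour of z, or an exchange would cover more of them. Let A be N together
   with one such vertex from each seagull; A is a clique of G with
   |N| + k >= l vertices, and if these are chosen well then, by exchanges again,
   N_T(A) meets each seagull in at most one vertex. Then l vertices of A and
   t - l vertices outside A and N_T(A) are the two sides of a model consisting of
   singletons.

   The general case reduces to this one by Gallai's lemma applied to T: if T is
   connected and every vertex is missed by some maximum matching of T, then
   maximum matchings miss at most one vertex, and |V| >= 2 chi - 1. If some
   vertex is covered by all maximum matchings, deleting it preserves chi; if T is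
   disconnected, G is a join and models of the two parts are combined. *)
Require Import Defs.
From mathcomp Require Import all_boot.
From mathcomp Require Import zify.

Set Implicit Arguments.
Unset Strict Implicit.
Unset Printing Implicit Defensive.

Section Nonadjacency.

Variable G : sgraph.
Implicit Types (x y z u v w : G) (V S : {set G}) (f g : {ffun G -> G}).

Definition nonadj : rel G := fun x y => (x != y) && ~~ adj x y.

Lemma nonadjC : symmetric nonadj.
Proof. by move=> x y; rewrite /nonadj eq_sym adj_sym. Qed.

Lemma nonadjN x y : x != y -> ~~ nonadj x y -> adj x y.
Proof. by rewrite /nonadj => ->; rewrite negbK. Qed.

Lemma nonadj_neq x y : nonadj x y -> x != y.
Proof. by case/andP. Qed.

(** * Pairings of nonadjacent vertices *)

(** A matching of T inside V, encoded as an involution of the whole vertex set: its fixed points are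
    the missed vertices together with everything outside V. *)
Definition pairing V f : bool :=
  [forall x, (f (f x) == x) &&
     ((f x == x) || [&& x \in V, f x \in V & nonadj x (f x)])].

Definition unpaired V f : {set G} := [set x in V | f x == x].

Lemma pairingP V f :
  reflect ((forall x, f (f x) = x) /\
           forall x, f x != x -> [/\ x \in V, f x \in V & nonadj x (f x)])
          (pairing V f).
Proof.
apply: (iffP forallP) => [H|[H1 H2] x].
  by split=> x; [case/andP: (H x) => /eqP | case/andP: (H x) => _ /orP[->//|/and3P]].
by rewrite H1 eqxx /=; case: eqVneq => //= /H2 [-> -> ->].
Qed.

Lemma pairingS V V' f : V \subset V' -> pairing V f -> pairing V' f.
Proof.
move=> /subsetP sVV' /pairingP [H1 H2]; apply/pairingP; split=> // x /H2 [*].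
by split; auto.
Qed.

Lemma pairing_out V f x : pairing V f -> x \notin V -> f x = x.
Proof. by case/pairingP => _ H; apply: contraNeq => /H []. Qed.

Lemma pairing_in V f x : pairing V f -> x \in V -> f x \in V.
Proof. by case/pairingP => _ H xV; case: (eqVneq (f x) x) => [->//|/H []]. Qed.

Lemma pairing1 V : pairing V [ffun x => x].
Proof. by apply/pairingP; split=> x; rewrite !ffunE ?eqxx. Qed.

(* The former partner [f y] of [y], if any, becomes unpaired. *)
Definition repair f x y : {ffun G -> G} :=
  [ffun v => if v == x then y else if v == y then x
             else if v == f y then v else f v].

Lemma repair_spec V f x y v : pairing V f -> f x = x -> x != y ->
  [\/ v = x /\ repair f x y v = y, v = y /\ repair f x y v = x,
      [/\ v != x, v != y, v = f y & repair f x y v = v] |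
      [/\ v != x, v != y & v != f y] /\
      [/\ f v != x, f v != y, f v != f y & repair f x y v = f v]].
Proof.
move=> /pairingP[ff _] fx nxy; rewrite ffunE.
have fI : injective f := can_inj ff.
case: (eqVneq v x) => [->|vx]; first by constructor 1.
case: (eqVneq v y) => [->|vy]; first by constructor 2.
case: (eqVneq v (f y)) => [->|vfy]; first by constructor 3; rewrite -?vfy.
constructor 4; split; split=> //.
- by apply: contraNneq vx => fvx; apply/eqP/fI; rewrite fx.
- by apply: contraNneq vfy => <-; rewrite ff.
- by rewrite (inj_eq fI).
Qed.

Lemma pairing_repair V f x y : pairing V f -> x \in V -> y \in V ->
  f x = x -> nonadj x y -> pairing V (repair f x y).
Proof.
move=> pf xV yV fx xy; have := pf; case/pairingP => ff fe.
have nxy := nonadj_neq xy.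
have R v := repair_spec v pf fx nxy.
have Rx : repair f x y x = y by rewrite ffunE eqxx.
have Ry : repair f x y y = x by rewrite ffunE eq_sym (negbTE nxy) eqxx.
apply/pairingP; split=> v.
- case: (R v) => [[-> ->]|[-> ->]|[_ _ _ e]|[[vx vy vfy] [fvx fvy fvfy ->]]] //.
    by rewrite !e.
  by rewrite ffunE (negbTE fvx) (negbTE fvy) (negbTE fvfy) ff.
- case: (R v) => [[-> ->]|[-> ->]|[_ _ _ ->]|[_ [_ _ _ ->]]].
  + by split.
  + by rewrite nonadjC.
  + by rewrite eqxx.
  + exact: fe.
Qed.

(** Only the former partner of y can be newly released. If y itself was unpaired, then [f y] is y,
    which is now paired with x, and [[set f y] :\ y] is empty. *)
Lemma unpaired_repair_sub V f x y : pairing V f -> f x = x -> x != y ->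
  unpaired V (repair f x y) \subset (unpaired V f :\ x) :|: [set f y] :\ y.
Proof.
move=> pf fx nxy; apply/subsetP => v; rewrite !inE => /andP[vV].
case: (repair_spec v pf fx nxy) =>
  [[-> ->]|[-> ->]|[vx vy ev _]|[[vx vy vfy] [_ _ _ ->]] -> ].
- by rewrite eq_sym (negbTE nxy).
- by rewrite (negbTE nxy).
- by move=> _; rewrite vy (introT eqP ev) orbT.
- by rewrite vx vV.
Qed.

Lemma unpaired_lt V f x y : pairing V f -> x \in V -> y \in V ->
  f x = x -> f y = y -> nonadj x y ->
  #|unpaired V (repair f x y)| < #|unpaired V f|.
Proof.
move=> pf xV yV fx fy xy; apply: proper_card; apply/properP; split.
  apply: subset_trans (unpaired_repair_sub pf fx (nonadj_neq xy)) _.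
  rewrite fy; apply/subsetP => v; rewrite !inE.
  by case: (v == y) => //=; rewrite orbF => /and3P[_ -> ->].
exists x; rewrite inE ?xV ?fx ?eqxx // ffunE eqxx.
by rewrite eq_sym (negbTE (nonadj_neq xy)) andbF.
Qed.

Lemma unpaired_le V f x y : pairing V f -> x \in V ->
  f x = x -> x != y ->
  #|unpaired V (repair f x y)| <= #|unpaired V f|.
Proof.
move=> pf xV fx nxy.
apply: leq_trans (subset_leq_card (unpaired_repair_sub pf fx nxy)) _.
apply: leq_trans (_ : #|(unpaired V f :\ x) :|: [set f y]| <= _).
  by apply: subset_leq_card; apply: setUS; apply: subsetDl.
rewrite (leq_trans (leq_card_setU _ _)) // cards1 addn1.
by rewrite [leqRHS](cardsD1 x) inE xV fx eqxx.
Qed.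

(** Pairs and single unpaired vertices are the classes of a proper colouring of V; counting each
    unpaired vertex twice gives twice the number m of classes. The identity also fixes the parity of
    the number of unpaired vertices. *)
Lemma pairing_parity V f : pairing V f ->
  exists2 m, #|V| + #|unpaired V f| = m.*2 &
  exists c : G -> G, #|c @: V| <= m /\
    {in V &, forall x y, adj x y -> c x != c y}.
Proof.
move=> pf; have [ff fe] := pairingP _ _ pf.
(* Ranks select a representative of each pair, which serves as its colour: A holds the lower-ranked
   partners, B the higher-ranked ones. *)
pose r := @enum_rank G.
pose A := [set x in V | r x < r (f x)]; pose B := [set x in V | r (f x) < r x].
have fI : injective f := can_inj ff.
have rI : injective (fun x => nat_of_ord (r x)).
  by move=> x y /val_inj /enum_rank_inj.
have AB : B = f @: A.
  apply/setP => x; apply/idP/imsetP => [|[y]]; rewrite !inE.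
    by move=> /andP[xV lt]; exists (f x); rewrite ?inE ff ?(pairing_in pf).
  by move=> /andP[yV lt] ->; rewrite ff (pairing_in pf).
have cAB : #|B| = #|A| by rewrite AB card_imset.
have Vd : #|V| = #|unpaired V f| + #|A| + #|B|.
  rewrite -cardsUI (_ : _ :&: _ = set0) ?cards0 ?addn0.
    rewrite -cardsUI (_ : _ :&: _ = set0) ?cards0 ?addn0.
      apply: eq_card => x; rewrite !inE; case: (x \in V) => //=.
      case: (eqVneq (f x) x) => [->|nf]; rewrite ?eqxx //=.
      have : nat_of_ord (r (f x)) != r x by apply: contra nf => /eqP /rI ->.
      by case: ltngtP.
    apply/setP => x; rewrite !inE; case: (x \in V) => //=.
    by case: (eqVneq (f x) x) => [->|_] /=; [rewrite ltnn | case: ltngtP].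
  apply/setP => x; rewrite !inE; case: (x \in V) => //=.
  by case: eqVneq => [->|] //=; rewrite ltnn.
exists (#|unpaired V f| + #|A|); first by lia.
exists (fun x => if r x < r (f x) then x else f x); split.
  apply: leq_trans (_ : #|unpaired V f :|: A| <= _); last first.
    by rewrite -cardsUI leq_addr.
  apply: subset_leq_card; apply/subsetP => y /imsetP[x xV ->].
  rewrite !inE; case: ifPn => [->|]; first by rewrite xV orbT.
  rewrite -leqNgt leq_eqVlt ff (pairing_in pf xV) /= => /orP[/eqP/rI e|->].
    by rewrite e eqxx.
  by rewrite orbT.
move=> x y xV yV axy; have nxy: x != y by apply: contraTneq axy => ->; rewrite adj_irrefl.
have nf : y != f x.
  apply: contraTneq axy => e; have := fe x; rewrite -e => /(_ _) [].
    by rewrite eq_sym.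
  by move=> _ _ /andP[].
case: ifP => _; case: ifP => _ //.
- by apply: contraNneq nf => ->; rewrite ff.
- by rewrite eq_sym.
- by rewrite (inj_eq fI).
Qed.

(** * Maximum matchings of T and Gallai's lemma *)

Definition optimal V f : bool :=
  pairing V f && [forall g, pairing V g ==> (#|unpaired V f| <= #|unpaired V g|)].

Lemma optimalP V f :
  reflect (pairing V f /\ forall g, pairing V g -> #|unpaired V f| <= #|unpaired V g|)
          (optimal V f).
Proof.
apply: (iffP andP) => -[pf H]; split=> //.
  by move=> g; apply/implyP/(forallP H).
by apply/forallP => g; apply/implyP/H.
Qed.

Lemma optimal_exists V : exists f, optimal V f.
Proof.
case: (arg_minnP (fun f => #|unpaired V f|) (pairing1 V)) => f pf H.
by exists f; apply/optimalP.
Qed.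

Definition co_unpaired V x y : bool :=
  [exists f, [&& optimal V f, f x == x & f y == y]].

(** The relation of Gallai's argument: when every vertex is missed by some maximum matching, it is
    an equivalence on V, and the first disjunct makes it reflexive. *)
Definition separated V x y : bool := (x == y) || ~~ co_unpaired V x y.

Lemma separatedC V x y : separated V x y = separated V y x.
Proof.
rewrite /separated eq_sym; congr (_ || ~~ _).
by apply: eq_existsb => f; rewrite andbCA andbC -andbA andbC -andbA; congr andb; rewrite andbC.
Qed.

Lemma separated_unpaired V f x y : separated V x y -> optimal V f ->
  f x = x -> x != y -> f y != y.
Proof.
rewrite /separated => /orP[/eqP->|/existsPn H]; first by rewrite eqxx.
by move=> of_ fx _; have := H f; rewrite of_ fx eqxx.
Qed.

(** A maximum matching missing both ends of a T-edge could be enlarged by that edge. *)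
Lemma nonadj_separated V x y : x \in V -> y \in V -> nonadj x y -> separated V x y.
Proof.
move=> xV yV xy; apply/orP; right; apply/existsPn => f.
apply/and3P => -[/optimalP[pf fmin] /eqP fx /eqP fy].
have := fmin _ (pairing_repair pf xV yV fx xy).
by rewrite leqNgt (unpaired_lt pf xV yV fx fy xy).
Qed.

(* Were x and y missed by an optimal M, take N optimal missing w and agreeing
   with M as often as possible; a vertex v <> w missed by N but not by M lets
   us re-pair v with M v in N and agree more often. *)
Lemma separated_trans V w x y :
  {in V, forall u, exists2 f, optimal V f & f u = u} ->
  w \in V -> x \in V -> y \in V ->
  separated V x w -> separated V w y -> separated V x y.
Proof.
move=> crit wV xV yV xw wy; apply: contraT.
rewrite negb_or negbK => /andP[nxy /existsP[M /and3P[oM /eqP Mx /eqP My]]].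
have [pM minM] := optimalP _ _ oM.
have nxw : x != w.
  apply/eqP => e; have : M y != y by apply: separated_unpaired oM Mx nxy; rewrite e.
  by rewrite My eqxx.
have nyw : y != w.
  apply/eqP => e; have : M x != x; last by rewrite Mx eqxx.
  by apply: separated_unpaired oM My _; rewrite 1?eq_sym // e separatedC.
have [N0 oN0 N0w] := crit w wV.
pose agree g := #|[set v | M v == g v]|.
have P0 : optimal V N0 && (N0 w == w) by rewrite oN0 N0w eqxx.
case: (@arg_maxnP _ N0 (fun g => optimal V g && (g w == w)) agree P0) => N /andP[oN /eqP Nw] maxN.
have [pN minN] := optimalP _ _ oN.
have [MM Me] := pairingP _ _ pM; have [NN Ne] := pairingP _ _ pN.
have NI : injective N := can_inj NN.
have Nx : N x != x.
  by rewrite separatedC in xw; apply: separated_unpaired xw oN Nw _; rewrite eq_sym.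
have Ny : N y != y by apply: separated_unpaired wy oN Nw _; rewrite eq_sym.
have Mw : M w != w by apply: separated_unpaired xw oM Mx nxw.
pose UM := unpaired V M; pose UN := unpaired V N.
have cardU : #|UM| = #|UN| by apply/eqP; rewrite eqn_leq minM ?minN.
(* M and N miss equally many vertices, and M alone misses x and y. So N alone misses at least two
   vertices, one of which differs from w. *)
have : 1 < #|UN :\: UM|.
  have -> : #|UN :\: UM| = #|UM :\: UN|.
    by apply/eqP; rewrite -(eqn_add2l #|UN :&: UM|) cardsID setIC cardsID cardU.
  rewrite (cardsD1 x) (cardsD1 y) !inE xV yV Mx My !eqxx (negbTE Nx) (negbTE Ny).
  by rewrite eq_sym nxy.
rewrite (cardsD1 w) !inE wV Nw eqxx (negbTE Mw) /= => lt0.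
have /card_gt0P[v] : 0 < #|(UN :\: UM) :\ w| by rewrite -ltnS.
rewrite !inE => /and3P[nvw Mv /andP[vV /eqP Nv]]; rewrite vV /= in Mv.
have [_ uV vu] := Me v Mv; set u := M v in uV vu.
have nvu := nonadj_neq vu.
(* Otherwise N misses both v and its T-neighbour w, and pairing them would improve N. *)
have nuw : u != w.
  apply/eqP => e; have := unpaired_lt pN vV uV Nv _ vu.
  by rewrite e Nw => /(_ erefl); rewrite ltnNge minN // -e pairing_repair.
have pN' := pairing_repair pN vV uV Nv vu.
have oN' : optimal V (repair N v u).
  apply/optimalP; split=> // g /minN; apply: leq_trans.
  exact: unpaired_le pN vV Nv nvu.
have N'w : repair N v u w = w.
  rewrite ffunE eq_sym (negbTE nvw) eq_sym (negbTE nuw) Nw.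
  by case: ifP.
have := maxN (repair N v u); rewrite oN' N'w eqxx => /(_ isT).
(* The re-pairing changes N only at v, u and [N u], where M and N disagreed; agreement at v is
   new. *)
rewrite /geq /= leqNgt => /negP[]; apply: proper_card; apply/properP; split.
  apply/subsetP => t; rewrite !inE => /eqP Mt.
  case: (repair_spec t pN Nv nvu) => [[et _]|[et _]|[tv tu et _]|[_ [_ _ _ ->]]].
  - by move: Mt Mv; rewrite et Nv => ->; rewrite eqxx.
  - move: Mt; rewrite et {1}/u MM => /esym /(congr1 N).
    by rewrite NN Nv => e; rewrite e eqxx in nvu.
  - move: Mt; rewrite et NN => /(congr1 M); rewrite MM => e; case/negP: tv.
    by rewrite et e /u MM.
  - exact/eqP.
exists v; rewrite !inE; last by rewrite Nv.
by rewrite ffunE eqxx.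
Qed.

(** If an optimal pairing misses both x and y, the class of x under [separated] omits y, and no
    T-edge leaves it, since nonadjacent vertices are separated and separation is transitive here.
    That class is [V1]. *)
Lemma gallai V :
  {in V, forall u, exists2 f, optimal V f & f u = u} ->
  (exists2 f, optimal V f & #|unpaired V f| <= 1) \/
  exists V1, [/\ V1 \subset V, V1 != set0, V :\: V1 != set0 &
                 {in V1 & V :\: V1, forall x y, adj x y}].
Proof.
move=> crit; have [f of_] := optimal_exists V.
have [|lt1] := leqP #|unpaired V f| 1; first by left; exists f.
have [x [y [xV yV fx fy nxy]]] : exists x y, [/\ x \in V, y \in V, f x = x, f y = y & x != y].
  have /card_gt0P[x xU] : 0 < #|unpaired V f| by lia.
  move: lt1; rewrite (cardsD1 x) xU add1n ltnS => /card_gt0P[y].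
  rewrite !inE => /and3P[nyx yV /eqP fy]; move: xU; rewrite inE => /andP[xV /eqP fx].
  by exists x, y; rewrite eq_sym.
right; exists [set v in V | separated V x v]; split.
- by apply/subsetP => v; rewrite inE => /andP[].
- by apply/set0Pn; exists x; rewrite inE xV /separated eqxx.
- apply/set0Pn; exists y; rewrite !inE yV andbT /=; apply/negP => xy.
  by have := separated_unpaired xy of_ fx nxy; rewrite fy eqxx.
- move=> u v; rewrite !inE => /andP[uV xu] /andP[]; rewrite negb_and => /orP[/negbTE->//|nxv vV].
  apply: nonadjN; first by apply: contraNneq nxv => <-.
  apply: contra nxv => uv; apply: separated_trans xu _ => //.
  exact: nonadj_separated.
Qed.

(** * Packings of seagulls *)

Definition no_stable3 : Prop :=
  forall x y z, nonadj x y -> nonadj y z -> ~~ nonadj x z.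

Definition seagull S : bool :=
  [exists u, exists v, exists w,
     [&& S == [set u; v; w], nonadj u v, adj w u & adj w v]].

Lemma seagullP S :
  reflect (exists u v w, [/\ S = [set u; v; w], nonadj u v, adj w u & adj w v])
          (seagull S).
Proof.
apply: (iffP existsP) => [[u /existsP[v /existsP[w /and4P[/eqP]]]]|[u [v [w [? ? ? ?]]]]].
  by exists u, v, w.
by exists u; apply/existsP; exists v; apply/existsP; exists w; apply/and4P; split=> //; apply/eqP.
Qed.

Lemma adj_neq x y : adj x y -> x != y.
Proof. by apply: contraTneq => ->; rewrite adj_irrefl. Qed.

Lemma adjNnonadj x y : adj x y -> nonadj x y = false.
Proof. by rewrite /nonadj => ->; rewrite andbF. Qed.

Lemma nonadj_seagull u v w : nonadj u v -> w != u -> w != v ->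
  ~~ nonadj w u -> ~~ nonadj w v -> seagull [set u; v; w].
Proof.
move=> uv wu wv wu' wv'; apply/seagullP; exists u, v, w.
by split=> //; apply: nonadjN.
Qed.

Lemma card_seagull S : seagull S -> #|S| = 3.
Proof.
move=> /seagullP[u [v [w [-> uv wu wv]]]].
rewrite -setUA cardsU1 cards2 !inE negb_or (nonadj_neq uv).
by rewrite eq_sym (adj_neq wu) eq_sym (adj_neq wv).
Qed.

Lemma seagull3 u v w : nonadj u v -> adj w u -> adj w v -> seagull [set u; v; w].
Proof. by move=> *; apply/seagullP; exists u, v, w. Qed.

(** If y is adjacent to both ends, it replaces the centre. If y is T-adjacent to the end u, it
    replaces the other end v when adjacent to the centre w; otherwise it replaces u, and v becomes
    the centre between y and w. *)
Lemma seagull_extend S y : no_stable3 -> seagull S -> y \notin S ->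
  exists S', [/\ seagull S', y \in S' & S' \subset y |: S].
Proof.
move=> tri /seagullP[u [v [w [-> uv wu wv]]]].
rewrite !inE !negb_or => /andP[/andP[yu yv] yw].
wlog yu' : u v uv wu wv yu yv / (nonadj y u) || ~~ nonadj y v.
  move=> H; have [|yu'] := boolP (nonadj y u || ~~ nonadj y v); first exact: H.
  have [||S' [sS yS sub]] := H v u _ wv wu yv yu.
  - by rewrite nonadjC.
  - by move: yu'; rewrite negb_or negbK => /andP[_ ->].
  - by exists S'; rewrite [[set u; v]]setUC.
have [{}yu'|Nyu] := boolP (nonadj y u); last first.
  exists [set u; v; y]; rewrite (negbTE Nyu) /= in yu'.
  rewrite seagull3 ?nonadjN // !inE eqxx orbT; split=> //.
  by rewrite !subUset !sub1set !inE !eqxx !orbT.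
have [yw'|yw'] := boolP (nonadj y w); last first.
  exists [set y; u; w]; rewrite seagull3 // 1?adj_sym ?nonadjN // 1?adj_sym // !inE eqxx.
  by rewrite !subUset !sub1set !inE !eqxx !orbT.
exists [set y; w; v]; rewrite seagull3 ?inE ?eqxx // 1?adj_sym //.
  by rewrite !subUset !sub1set !inE !eqxx !orbT.
by apply: nonadjN => //; apply: tri yu' uv.
Qed.

(** Inside a seagull T has a single edge, the one joining the ends. *)
Lemma seagull_nonadj_le1 S s x y : no_stable3 -> seagull S ->
  s \in S -> x \in S -> y \in S -> nonadj s x -> nonadj s y -> x = y.
Proof.
move=> tri /seagullP[u [v [w [-> uv wu wv]]]].
have N a : nonadj a a = false by rewrite /nonadj eqxx.
have uw : nonadj u w = false by rewrite nonadjC adjNnonadj.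
have vw : nonadj v w = false by rewrite nonadjC adjNnonadj.
by rewrite !inE -!orbA => /or3P[]/eqP-> /or3P[]/eqP-> /or3P[]/eqP->; rewrite ?N ?(adjNnonadj wu) ?(adjNnonadj wv) ?uw ?vw.
Qed.

Definition packing V k (P : {ffun 'I_k -> {set G}}) : bool :=
  [forall i, seagull (P i) && (P i \subset V)] &&
  [forall i, forall j, (i != j) ==> [disjoint P i & P j]].

Lemma packingP V k (P : {ffun 'I_k -> {set G}}) :
  reflect [/\ forall i, seagull (P i), forall i, P i \subset V &
              forall i j x, x \in P i -> x \in P j -> i = j]
          (packing V P).
Proof.
apply: (iffP andP) => [[/forallP H1 /forallP H2]|[H1 H2 H3]]; split.
- by move=> i; case/andP: (H1 i).
- by move=> i; case/andP: (H1 i).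
- move=> i j x xi xj; apply/eqP; apply: contraT => nij.
  have /forallP/(_ j) := H2 i; rewrite nij => /disjointFr/(_ xi).
  by rewrite xj.
- by apply/forallP => i; rewrite H1 H2.
- apply/forallP => i; apply/forallP => j; apply/implyP => nij.
  rewrite disjoints_subset; apply/subsetP => x xi; rewrite inE.
  by apply: contra nij => xj; rewrite (H3 _ _ _ xi xj).
Qed.

Definition leftover V k (P : {ffun 'I_k -> {set G}}) : {set G} :=
  V :\: \bigcup_i P i.

Lemma leftoverP V k (P : {ffun 'I_k -> {set G}}) x :
  reflect (x \in V /\ forall i, x \notin P i) (x \in leftover V P).
Proof.
rewrite inE andbC; apply: (iffP andP) => -[xV H]; split=> //.
  by move=> i; apply: contra H => xi; apply/bigcupP; exists i.
by apply/bigcupP => -[i _]; apply/negP.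
Qed.

Lemma card_leftover V k (P : {ffun 'I_k -> {set G}}) :
  packing V P -> #|leftover V P| + 3 * k = #|V|.
Proof.
case/packingP => H1 H2 H3.
have c : #|\bigcup_i P i| = 3 * k.
  rewrite -sum1_card (partition_disjoint_bigcup _ (fun _ => 1)).
    rewrite (eq_bigr (fun _ => 3)) ?sum_nat_const ?card_ord 1?mulnC //.
    by move=> i _; rewrite sum1_card card_seagull.
  move=> i j nij; rewrite disjoints_subset; apply/subsetP => x xi; rewrite inE.
  by apply: contra nij => xj; rewrite (H3 _ _ _ xi xj).
have sV : \bigcup_i P i \subset V by apply/bigcupsP.
by rewrite -c addnC -(cardsID (\bigcup_i P i) V) (setIidPr sV).
Qed.

Definition replace k (P : {ffun 'I_k -> {set G}}) i S : {ffun 'I_k -> {set G}} :=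
  [ffun j => if j == i then S else P j].

Lemma packing_replace V k (P : {ffun 'I_k -> {set G}}) i S :
  packing V P -> seagull S -> S \subset P i :|: leftover V P ->
  packing V (replace P i S).
Proof.
move=> /packingP[H1 H2 H3] sS sub.
have D j x : x \in S -> x \in P j -> j = i.
  move=> xS xj; have := subsetP sub x xS; rewrite in_setU => /orP[xi|/leftoverP[_ /(_ j)]].
    exact: H3 xj xi.
  by rewrite xj.
apply/packingP; split=> [j|j|j m x]; rewrite !ffunE.
- by case: ifP.
- case: ifP => // _; apply/subsetP => x /(subsetP sub); rewrite in_setU.
  by case/orP => [/(subsetP (H2 i))|/leftoverP[]].
- case: eqVneq => [->|nj]; case: eqVneq => [->|nm] //.
  + by move=> xS /(D _ _ xS) e; rewrite e eqxx in nm.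
  + by move=> /[swap] xS /(D _ _ xS) e; rewrite e eqxx in nj.
  + exact: H3.
Qed.

(** * Packings that cover as many T-neighbours of z as possible *)

Definition coverage k (P : {ffun 'I_k -> {set G}}) z : nat :=
  \sum_i #|[set x in P i | nonadj z x]|.

Lemma coverage_replace k (P : {ffun 'I_k -> {set G}}) i S z :
  coverage (replace P i S) z + #|[set x in P i | nonadj z x]| =
  coverage P z + #|[set x in S | nonadj z x]|.
Proof.
rewrite /coverage (bigD1 i) //= [in RHS](bigD1 i) //= ffunE eqxx.
rewrite (eq_bigr (fun j => #|[set x in P j | nonadj z x]|)); first by rewrite addnC -[RHS]addnA (addnC #|[set x in S | _]|).
by move=> j /negbTE nj; rewrite ffunE nj.
Qed.

Definition max_coverage V k (P : {ffun 'I_k -> {set G}}) z : Prop :=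
  packing V P /\ forall Q, @packing V k Q -> coverage Q z <= coverage P z.

Lemma max_coverage_exists V k (P : {ffun 'I_k -> {set G}}) z :
  packing V P -> exists Q : {ffun 'I_k -> {set G}}, max_coverage V Q z.
Proof.
move=> pP; case: (@arg_maxnP _ P (@packing V k) (fun Q => coverage Q z) pP) => Q pQ mQ.
by exists Q.
Qed.

Lemma max_coverage_replace V k (P : {ffun 'I_k -> {set G}}) z i S :
  max_coverage V P z -> seagull S -> S \subset P i :|: leftover V P ->
  #|[set x in S | nonadj z x]| <= #|[set x in P i | nonadj z x]|.
Proof.
move=> [pP mP] sS sub; have := mP _ (packing_replace pP sS sub).
by have := coverage_replace P i S z; lia.
Qed.

(** Here s is the only T-neighbour of z in the seagull, and y is an uncovered one; s and y are not
    T-adjacent. If x told them apart, s, y, x would span exactly one T-edge and form a seagull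
    covering two T-neighbours of z, against maximality. *)
Lemma coverage_twin V k (P : {ffun 'I_k -> {set G}}) z i s y x :
  no_stable3 -> max_coverage V P z ->
  s \in P i -> nonadj z s -> #|[set x in P i | nonadj z x]| <= 1 ->
  y \in leftover V P -> nonadj z y -> x \in P i ->
  nonadj y x = nonadj s x.
Proof.
move=> tri mP si zs le1 yL zy xi; have := mP => -[/packingP[Hs HV Hd] _].
have [yV yP] := leftoverP _ _ _ yL.
have ys : y != s by apply: contraTneq si => <-.
have nys : ~~ nonadj y s by apply: tri zs; rewrite nonadjC.
have [<-|sx] := eqVneq s x; first by rewrite (negbTE nys) /nonadj eqxx.
have yx : y != x by apply: contraTneq xi => <-.
have nsy : ~~ nonadj s y by rewrite nonadjC.
have K : seagull [set s; y; x] -> False.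
  move=> sS; have : [set s; y; x] \subset P i :|: leftover V P.
    by rewrite !subUset !sub1set !in_setU si xi yL orbT.
  move=> /(max_coverage_replace mP sS); rewrite leqNgt => /negP[].
  apply: leq_ltn_trans le1 _.
  rewrite (cardsD1 s) !inE eqxx zs (cardsD1 y) !inE eqxx zy orbT !andbT.
  by rewrite ys.
have [yx'|yx'] := boolP (nonadj y x); have [sx'|sx'] := boolP (nonadj s x) => //.
  case: K; rewrite (_ : [set s; y; x] = [set y; x; s]).
    by apply: nonadj_seagull; rewrite // eq_sym.
  by rewrite -setUA setUC.
case: K; rewrite (_ : [set s; y; x] = [set s; x; y]); last by rewrite setUAC.
exact: nonadj_seagull.
Qed.

Lemma coverage_exchange V k (P : {ffun 'I_k -> {set G}}) z i y0 :
  no_stable3 -> max_coverage V P z ->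
  y0 \in leftover V P -> nonadj z y0 ->
  exists t, [/\ t \in P i, nonadj z t & seagull (y0 |: P i :\ t)].
Proof.
move=> tri mP y0L zy0; have := mP => -[/packingP[Hs HV Hd] _].
have NL y : y \in leftover V P -> y \notin P i by case/leftoverP.
(* If [P i] contained no T-neighbour of z, exchanging y0 into it would raise the coverage. *)
have [s si zs] : exists2 s, s \in P i & nonadj z s.
  have [S' [sS' yS' sub]] := seagull_extend tri (Hs i) (NL _ y0L).
  have : #|[set x in S' | nonadj z x]| <= #|[set x in P i | nonadj z x]|.
    apply: max_coverage_replace mP sS' _; apply: subset_trans sub _.
    by rewrite subUset subsetUl sub1set in_setU y0L orbT.
  have : 0 < #|[set x in S' | nonadj z x]| by apply/card_gt0P; exists y0; rewrite inE yS'.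
  move=> lt /(leq_trans lt) /card_gt0P[s]; rewrite inE => /andP[? ?].
  by exists s.
have := Hs i => /seagullP[u [v [w [eS uv wu wv]]]].
have nuv := nonadj_neq uv; have nwu := adj_neq wu; have nwv := adj_neq wv.
have nL y a : y \in leftover V P -> a \in P i -> y != a.
  by move=> yL; apply: contraTneq => <-; apply: NL.
have [ui vi wi] : [/\ u \in P i, v \in P i & w \in P i].
  by rewrite eS !inE !eqxx !orbT.
have Ew : P i :\ w = [set u; v].
  rewrite eS; apply/setP => q; rewrite !inE; case: (eqVneq q w) => [->|_] /=.
    by rewrite (negbTE nwu) (negbTE nwv).
  by rewrite orbF.
have Eu : P i :\ u = [set v; w].
  rewrite eS; apply/setP => q; rewrite !inE; case: (eqVneq q u) => [->|_] //=.
  by rewrite (negbTE nuv) eq_sym (negbTE nwu).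
have Ev : P i :\ v = [set u; w].
  rewrite eS; apply/setP => q; rewrite !inE; case: (eqVneq q v) => [->|_] /=.
    by rewrite eq_sym (negbTE nuv) eq_sym (negbTE nwv).
  by rewrite orbF.
have Su y : y \in leftover V P -> nonadj y v -> ~~ nonadj y w -> seagull (y |: P i :\ u).
  move=> yL yv yw; rewrite Eu setUA seagull3 //.
  by rewrite adj_sym nonadjN // nL.
have Sv y : y \in leftover V P -> nonadj y u -> ~~ nonadj y w -> seagull (y |: P i :\ v).
  move=> yL yv yw; rewrite Ev setUA seagull3 //.
  by rewrite adj_sym nonadjN // nL.
have Sw y : y \in leftover V P -> ~~ nonadj y u -> ~~ nonadj y v -> seagull (y |: P i :\ w).
  move=> yL yu yv; rewrite Ew setUC seagull3 //; by rewrite nonadjN // nL.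
have vu : nonadj v u by rewrite nonadjC.
have uw : nonadj u w = false by rewrite nonadjC adjNnonadj.
have vw : nonadj v w = false by rewrite nonadjC adjNnonadj.
(* With a single T-neighbour s in [P i], y0 is its twin and takes its place. *)
have [le1|gt1] := leqP #|[set x in P i | nonadj z x]| 1.
  have tw := coverage_twin tri mP si zs le1 y0L zy0.
  exists s; split=> //; move: si; rewrite {1}eS !inE -orbA.
  case/or3P => /eqP e; rewrite e.
  - by apply: Su; rewrite // tw // e ?uv ?uw.
  - by apply: Sv; rewrite // tw // e ?vu ?vw.
  - by apply: Sw; rewrite // tw // e adjNnonadj.
have T x y : nonadj z x -> nonadj z y -> ~~ nonadj x y.
  by move=> zx; apply: tri; rewrite nonadjC.
(* The ends are T-adjacent, so they are not both T-neighbours of z. Hence z is T-adjacent to the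
   centre and one end. Below, y0 replaces the end opposite to its own T-neighbour, or the centre if
   it is T-adjacent to neither end. *)
have [zw zuv] : nonadj z w /\ (nonadj z u || nonadj z v).
  case/card_gt1P: gt1 => a [b []]; rewrite !inE eS !inE -!orbA => /andP[a3 za] /andP[b3 zb].
  have := T u v; rewrite uv => Tuv; move: za zb.
  case/or3P: a3 => /eqP->; case/or3P: b3 => /eqP->; rewrite ?eqxx // => za zb _;
    rewrite ?za ?zb ?orbT //; by have := Tuv _ _; rewrite ?za ?zb => /(_ isT isT).
have [y0u|y0u] := boolP (nonadj y0 u).
  have zv : nonadj z v.
    by case/orP: zuv => // zu; have := T _ _ zy0 zu; rewrite y0u.
  by exists v; split=> //; apply: Sv => //; apply: T.
have [y0v|y0v] := boolP (nonadj y0 v); last by exists w; split=> //; apply: Sw.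
have zu : nonadj z u.
  by case/orP: zuv => // zv; have := T _ _ zy0 zv; rewrite y0v.
by exists u; split=> //; apply: Su => //; apply: T.
Qed.

(** As A consists of T-neighbours of z, triangle-freeness keeps every T-neighbour of z, in
    particular all of N, out of its T-neighbourhood D. So the uncovered part of D lies in the
    leftover minus N, and each seagull adds at most one vertex. *)
Lemma coverage_clique V k (P : {ffun 'I_k -> {set G}}) z :
  no_stable3 -> max_coverage V P z ->
  let N := [set x in leftover V P | nonadj z x] in
  N != set0 ->
  exists A : {set G}, [/\ A \subset V, {in A, forall a, nonadj z a}, #|A| = #|N| + k &
    #|[set x in V | [exists a in A, nonadj a x]]| <= #|leftover V P| - #|N| + k].
Proof.
move=> tri mP N /set0Pn[y0]; rewrite inE => /andP[y0L zy0].
have NP x : x \in N -> x \in leftover V P /\ nonadj z x by rewrite in_set => /andP[].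
have := mP => -[pP _]; have [Hs HV Hd] := packingP _ _ pP.
have T x y : nonadj z x -> nonadj z y -> ~~ nonadj x y.
  by move=> zx; apply: tri; rewrite nonadjC.
have Ht i := coverage_exchange i tri mP y0L zy0.
have [t tP] := fin_all_exists Ht.
have tI : injective t.
  by move=> i j e; apply: (Hd _ _ (t i)); [|rewrite e]; case: (tP i) (tP j) => [? _ _] [].
exists (N :|: t @: 'I_k); split.
- rewrite subUset; apply/andP; split; apply/subsetP => x.
    by case/NP => /leftoverP[].
  by case/imsetP => i _ ->; apply: (subsetP (HV i)); case: (tP i).
- move=> a; rewrite in_setU => /orP[|/imsetP[i _ ->]]; last by case: (tP i).
  by case/NP.
- rewrite cardsU card_imset // card_ord (_ : _ :&: _ = set0) ?cards0 ?subn0 //.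
  apply/setP => x; rewrite in_setI in_set0; apply/negP => /andP[/NP[/leftoverP[_ xP] _]].
  by case/imsetP => i _ e; have := xP i; rewrite e; case: (tP i) => ->.
set A := _ :|: _; set D := [set x in V | _].
have zA a : a \in A -> nonadj z a.
  rewrite in_setU => /orP[|/imsetP[i _ ->]]; last by case: (tP i).
  by case/NP.
have zD x : x \in D -> ~~ nonadj z x.
  rewrite inE => /andP[_ /existsP[a /andP[aA ax]]].
  by apply: contraL ax; apply: T; apply: zA.
have DP x : x \in D -> exists2 a, a \in A & nonadj a x.
  by rewrite inE => /andP[_ /existsP[a /andP[aA ax]]]; exists a.
(* Two T-neighbours of z in [P i] leave one candidate for D. With only one, namely [t i], all of D
   in [P i] is shown to be T-adjacent to [t i], hence at most one vertex. *)
have Di i : #|D :&: P i| <= 1.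
  have [le1|gt1] := leqP #|[set x in P i | nonadj z x]| 1; last first.
    have := card_seagull (Hs i); rewrite -(cardsID [set x | nonadj z x] (P i)) -setIdE => c3.
    suff : #|D :&: P i| <= #|P i :\: [set x | nonadj z x]| by move=> /leq_trans; apply; lia.
    by apply: subset_leq_card; apply/subsetP => x; rewrite in_setI in_setD [_ \in finset (fun _ => nonadj _ _)]in_set => /andP[/zD -> ->].
  have [ti zti _] := tP i.
  have key x : x \in D -> x \in P i -> nonadj (t i) x.
    move=> xD xi; have [a] := DP x xD; rewrite in_setU => /orP[/NP[aL za]|/imsetP[j _ ->]].
      by rewrite (coverage_twin tri mP ti zti le1 aL za xi).
    have [->|nji] := eqVneq j i; first by [].
    (* For a vertex of D reached from [t j], swap [t j] for y0 in [P j]. Both are T-neighbours of z,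
       so coverage stays maximal; now [t j] is uncovered and is a twin of [t i]. *)
    have [tj ztj stj] := tP j.
    have nyt : y0 != t j by apply: contraTneq y0L => ->; apply/leftoverP => -[_ /(_ j)]; rewrite tj.
    have sub : y0 |: P j :\ t j \subset P j :|: leftover V P.
      by rewrite subUset sub1set in_setU y0L orbT (subset_trans (subsetDl _ _)) ?subsetUl.
    pose Q := replace P j (y0 |: P j :\ t j).
    have pQ : packing V Q := packing_replace pP stj sub.
    have Qi : Q i = P i by rewrite ffunE eq_sym (negbTE nji).
    have mQ : max_coverage V Q z.
      split=> // R pR; apply: leq_trans (proj2 mP R pR) _.
      have := coverage_replace P j (y0 |: P j :\ t j) z; rewrite -/Q => e.
      rewrite -(leq_add2r #|[set x in P j | nonadj z x]|) e leq_add2l.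
      rewrite (cardsD1 (t j)) [leqRHS](cardsD1 y0) !inE tj ztj zy0 eqxx.
      rewrite leq_add2l; apply: subset_leq_card; apply/subsetP => q.
      rewrite !inE => /and3P[-> qj ->]; rewrite qj orbT /= andbT.
      by apply: contraTneq qj => ->; case/leftoverP: y0L.
    have tL : t j \in leftover V Q.
      apply/leftoverP; split; first exact: (subsetP (HV j)).
      move=> m; rewrite ffunE; case: eqVneq => [_|nm].
        by rewrite !inE eqxx eq_sym (negbTE nyt).
      by apply: contra nm => tm; rewrite (Hd _ _ _ tm tj).
    by rewrite (coverage_twin (i := i) tri mQ _ zti _ tL ztj) ?Qi.
  rewrite leqNgt; apply/negP => /card_gt1P[x [y []]]; rewrite !in_setI => /andP[xD xi] /andP[yD yi].
  move/eqP; apply.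
  exact: seagull_nonadj_le1 tri (Hs i) ti xi yi (key x xD xi) (key y yD yi).
have sD : D \subset (leftover V P :\: N) :|: \bigcup_i (D :&: P i).
  apply/subsetP => x xD; have xV : x \in V by move: xD; rewrite inE => /andP[].
  rewrite in_setU; have [/bigcupP[i _ xi]|xP] := boolP (x \in \bigcup_i P i).
    by apply/orP; right; apply/bigcupP; exists i; rewrite // in_setI xD.
  by rewrite in_setD [x \in leftover _ _]in_setD xP xV /= andbT; apply/orP; left; apply: contra (zD x xD) => /NP[].
apply: leq_trans (subset_leq_card sD) _.
apply: leq_trans (leq_card_setU _ _) _; apply: leq_add.
  by rewrite cardsDS //; apply/subsetP => x /NP[].
have : \sum_i #|D :&: P i| <= k.
  apply: leq_trans (_ : \sum_(i < k) 1 <= _); last by rewrite sum1_card card_ord.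
  by apply: leq_sum => i _; apply: Di.
apply: leq_trans; elim/big_ind2: _ => // [|m1 B1 m2 B2 h1 h2]; first by rewrite cards0.
by apply: leq_trans (leq_card_setU _ _) _; apply: leq_add.
Qed.

(** * Branch sets *)

(* Branch sets are singletons or seagulls, the latter listed as [:: end; centre; end]. *)
Definition branch (b : seq G) : bool :=
  match b with
  | [:: _] => true
  | [:: u; w; v] => [&& adj u w, adj w v & nonadj u v]
  | _ => false
  end.

(* Every vertex outside a seagull is adjacent to one of its ends, so only
   singletons need to be checked for adjacency. *)
Definition bipartite_branches V (a b : nat) : Prop :=
  exists sA sB : seq (seq G),
    [/\ a <= size sA, b <= size sB & all branch (sA ++ sB)] /\
    [/\ uniq (flatten (sA ++ sB)), {subset flatten (sA ++ sB) <= V} &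
        forall x y, [:: x] \in sA -> [:: y] \in sB -> adj x y].

Lemma bipartite_branchesC V a b :
  bipartite_branches V a b -> bipartite_branches V b a.
Proof.
move=> [sA [sB [[lA lB br] [un sub ad]]]]; exists sB, sA; split; split=> //.
- by rewrite all_cat andbC -all_cat.
- by rewrite flatten_cat uniq_catC -flatten_cat.
- by move=> x xf; apply: sub; move: xf; rewrite !flatten_cat !mem_cat orbC.
- by move=> x y xB yA; rewrite adj_sym ad.
Qed.

Lemma bipartite_branchesS V V' a b : V \subset V' ->
  bipartite_branches V a b -> bipartite_branches V' a b.
Proof.
move=> /subsetP sV [sA [sB [? [un sub ad]]]]; exists sA, sB; split=> //.
by split=> // x /sub /sV.
Qed.

Lemma bipartite_branches_join V1 V2 a1 b1 a2 b2 :
  [disjoint V1 & V2] -> {in V1 & V2, forall x y, adj x y} ->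
  bipartite_branches V1 a1 b1 -> bipartite_branches V2 a2 b2 ->
  bipartite_branches (V1 :|: V2) (a1 + a2) (b1 + b2).
Proof.
move=> dis ad12 [sA1 [sB1 [[lA1 lB1 br1] [un1 sub1 ad1]]]].
move=> [sA2 [sB2 [[lA2 lB2 br2] [un2 sub2 ad2]]]].
have P : perm_eq ((sA1 ++ sA2) ++ (sB1 ++ sB2)) ((sA1 ++ sB1) ++ (sA2 ++ sB2)).
  by rewrite -!catA perm_cat2l !catA perm_cat2r perm_catC.
have PF := perm_flatten P.
have m1 x : ([:: x] \in sA1) || ([:: x] \in sB1) -> x \in V1.
  by rewrite -mem_cat => xs; apply: sub1; apply/flattenP; exists [:: x]; rewrite ?mem_head.
have m2 x : ([:: x] \in sA2) || ([:: x] \in sB2) -> x \in V2.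
  by rewrite -mem_cat => xs; apply: sub2; apply/flattenP; exists [:: x]; rewrite ?mem_head.
exists (sA1 ++ sA2), (sB1 ++ sB2); split; split.
- by rewrite size_cat leq_add.
- by rewrite size_cat leq_add.
- by rewrite (perm_all _ P) all_cat br1.
- rewrite (perm_uniq PF) flatten_cat cat_uniq un1 un2 andbT /=.
  apply/hasPn => x /sub2 x2; apply/negP => /sub1 x1.
  by rewrite (disjointFr dis x1) in x2.
- move=> x; rewrite (perm_mem PF) flatten_cat mem_cat inE.
  by case/orP => [/sub1->|/sub2->]; rewrite ?orbT.
- move=> x y; rewrite !mem_cat => /orP[xA|xA] /orP[yB|yB].
  + exact: ad1.
  + by apply: ad12; [apply: m1 | apply: m2]; rewrite ?xA ?yB ?orbT.
  + by rewrite adj_sym; apply: ad12; [apply: m1 | apply: m2]; rewrite ?xA ?yB ?orbT.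
  + exact: ad2.
Qed.

Lemma seagull_branch S : seagull S ->
  exists b, [/\ branch b, size b = 3, uniq b & b =i S].
Proof.
move=> /seagullP[u [v [w [-> uv wu wv]]]]; exists [:: u; w; v]; split=> //=.
- by rewrite adj_sym wu wv uv.
- by rewrite !inE negb_or eq_sym (adj_neq wu) (nonadj_neq uv) (adj_neq wv).
- by move=> x; rewrite !inE orbAC -orbA.
Qed.

(** All seagulls go to the first side, so only adjacency between the singletons from [XA] and [XB]
    has to be assumed. *)
Lemma packing_branches V k (P : {ffun 'I_k -> {set G}}) (XA XB : {set G}) :
  packing V P -> XA \subset leftover V P -> XB \subset leftover V P ->
  {in XA & XB, forall x y, adj x y} ->
  bipartite_branches V (k + #|XA|) #|XB|.
Proof.
move=> pP /subsetP sA /subsetP sB ad; have [Hs HV Hd] := packingP _ _ pP.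
have [br brP] := fin_all_exists (fun i => seagull_branch (Hs i)).
have P1 (X : {set G}) : flatten [seq [:: x] | x <- enum X] = enum X.
  by rewrite flatten_map1 map_id.
have FP x : x \in flatten [seq br i | i <- enum [set: 'I_k]] -> exists i, x \in P i.
  case/flattenP => s /mapP[i _ ->]; case: (brP i) => _ _ _ -> xi.
  by exists i.
exists ([seq br i | i <- enum [set: 'I_k]] ++ [seq [:: x] | x <- enum XA]),
  [seq [:: x] | x <- enum XB].
split; split.
- by rewrite size_cat !size_map -!cardE cardsT card_ord.
- by rewrite size_map -cardE.
- rewrite !all_cat -andbA; apply/and3P; split; apply/allP => s /mapP[x _ ->] //.
  by case: (brP x).
- rewrite !flatten_cat !P1 -catA cat_uniq; apply/and3P; split.
  + elim: (enum _) (enum_uniq [set: 'I_k]) => //= i s IH /andP[is_ us].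
    rewrite cat_uniq IH // andbT; case: (brP i) => _ _ -> bi /=.
    apply/hasPn => x /flattenP[c /mapP[j js ->]]; case: (brP j) => _ _ _ -> xj.
    by apply: contra is_; rewrite bi => xi; rewrite (Hd _ _ _ xi xj).
  + apply/hasPn => x; rewrite mem_cat !mem_enum => xX.
    have /leftoverP[_ xP] : x \in leftover V P by case/orP: xX; auto.
    by apply/negP => /FP[i]; apply/negP.
  + rewrite cat_uniq !enum_uniq andbT /=; apply/hasPn => x; rewrite !mem_enum => xB.
    by apply/negP => xA; have := adj_neq (ad _ _ xA xB); rewrite eqxx.
- move=> x; rewrite !flatten_cat !P1 !mem_cat !mem_enum => /orP[/orP[/FP[i]|/sA]|/sB].
  + exact: (subsetP (HV i)).
  + by case/leftoverP.
  + by case/leftoverP.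
- move=> x y; rewrite mem_cat => /orP[/mapP[i _ e]|/mapP[x' xA [->]]].
    by case: (brP i) => _; rewrite -e.
  by move=> /mapP[y' yB [->]]; apply: ad; rewrite -mem_enum.
Qed.

(** * The case of at least 2t - 1 vertices *)

Lemma packing0 V (P : {ffun 'I_0 -> {set G}}) : packing V P.
Proof. by apply/packingP; split=> - []. Qed.

Lemma packing_extend V k (P : {ffun 'I_k -> {set G}}) S :
  packing V P -> seagull S -> S \subset leftover V P ->
  exists Q : {ffun 'I_k.+1 -> {set G}}, packing V Q.
Proof.
move=> /packingP[Hs HV Hd] sS /subsetP sub.
exists [ffun i => if unlift ord0 i is Some j then P j else S].
apply/packingP; split=> [i|i|i j x]; rewrite !ffunE.
- by case: unliftP => [m _|].
- case: unliftP => [m _|_]; first exact: HV.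
  by apply/subsetP => x /sub /leftoverP[].
- case: unliftP => [m ->|->]; case: unliftP => [m' ->|->] //.
  + by move=> xm xm'; rewrite (Hd _ _ _ xm xm').
  + by move=> xm /sub /leftoverP[_ /(_ m)]; rewrite xm.
  + by move=> /sub /leftoverP[_ /(_ m')] /negP.
Qed.

Lemma subset_of_card (A : {set G}) m : m <= #|A| ->
  exists2 B : {set G}, B \subset A & #|B| = m.
Proof.
move=> le; exists [set x in take m (enum A)].
  by apply/subsetP => x; rewrite inE => /mem_take; rewrite mem_enum.
rewrite cardsE; have /card_uniqP -> : uniq (take m (enum A)) by rewrite take_uniq ?enum_uniq.
by rewrite size_take -cardE; case: ltngtP le.
Qed.

Lemma branches_large V t l : no_stable3 -> t.*2 <= #|V|.+1 ->
  0 < l -> l.*2 <= t -> bipartite_branches V l (t - l).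
Proof.
move=> tri tV l0 lt.
pose has_packing k := [exists P : {ffun 'I_k -> {set G}}, packing V P].
have ex0 : exists k, (k < l) && has_packing k.
  by exists 0; rewrite l0; apply/existsP; exists [ffun=> set0]; apply: packing0.
have le k : (k < l) && has_packing k -> k <= l by case/andP => /ltnW.
case: (ex_maxnP ex0 le) => k /andP[kl /existsP[P pP]] maxk {ex0 le}.
have cP := card_leftover pP.
have /card_gt0P[z zL] : 0 < #|leftover V P| by clear - cP kl lt tV; lia.
have [zV zP] := leftoverP _ _ _ zL.
have cV : #|V| = #|V :\ z|.+1 by rewrite (cardsD1 z V) zV.
have pPz : packing (V :\ z) P.
  have [Hs HV Hd] := packingP _ _ pP; apply/packingP; split=> // i.
  by apply/subsetP => x xi; rewrite !inE (subsetP (HV i)) // andbT; apply: contraTneq xi => ->.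
have [Q mQ] := max_coverage_exists z pPz.
have [pQz _] := mQ; have cQ := card_leftover pQz.
set L := leftover (V :\ z) Q in cQ.
have [N eN] : exists N : {set G}, N = [set x in L | nonadj z x] by eexists.
have sN : N \subset L by rewrite eN; apply/subsetP => x; rewrite inE => /andP[].
have NL := subset_leq_card sN.
have [leN|ltN] := leqP t (k.*2 + #|N|).
  have N0 : [set x in L | nonadj z x] != set0.
    by rewrite -eN -card_gt0; clear - leN kl lt; lia.
  have [A [sA zA cA cD]] := coverage_clique tri mQ N0.
  rewrite -/L -eN in cA cD; set D := [set x in V :\ z | _] in cD.
  (* Here |A| = |N| + k >= t - k >= l, as t >= 2l and k < l. *)
  have [XA sXA cXA] : exists2 B : {set G}, B \subset A & #|B| = l.
    by apply: subset_of_card; clear - cA leN kl lt; lia.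
  have sub1 : XA \subset V by rewrite (subset_trans sXA) // (subset_trans sA) // subsetDl.
  pose XB := (V :\ z) :\: (XA :|: D).
  (* From |V - z| = |L| + 3k and |D| <= |L| - |N| + k, at least 2k + |N| - l vertices remain; the
     case threshold makes this at least t - l. *)
  have cXB : t - l <= #|XB|.
    have := cardsID (XA :|: D) (V :\ z); rewrite -/XB => c1.
    have c2 : #|(V :\ z) :&: (XA :|: D)| <= #|XA| + #|D|.
      by apply: leq_trans (leq_card_setU XA D); apply/subset_leq_card/subsetIr.
    move: c1 c2 cD; move: #|_ :&: _| #|XB| #|D| => c1 c2 c3.
    clear - cXA cV cQ NL leN kl lt tV; lia.
  have [XB' sXB' cXB'] := subset_of_card cXB.
  have LV : leftover V [ffun _ : 'I_0 => set0] = V by rewrite /leftover big_ord0 setD0.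
  rewrite -cXB' -[l in bipartite_branches _ l _]add0n -cXA.
  apply: (packing_branches (P := [ffun=> set0])); rewrite ?LV //.
  - exact: packing0.
  - apply: subset_trans sXB' _; apply: subset_trans (subsetDl _ _) _; exact: subsetDl.
  - move=> x y xA /(subsetP sXB'); rewrite in_setD in_setU negb_or.
    case/andP => /andP[yA yD] yV; apply: nonadjN; first by apply: contraNneq yA => <-.
    apply: contra yD => xy; rewrite in_set yV; apply/existsP; exists x.
    by rewrite (subsetP sXA).
have pQ : packing V Q.
  have [Hs HV Hd] := packingP _ _ pQz; apply/packingP; split=> // i.
  by apply: subset_trans (HV i) (subsetDl _ _).
have LL x : x \in L -> x \in leftover V Q.
  by case/leftoverP => xV xQ; apply/leftoverP; split=> //; case/setD1P: xV.
have zQ : z \in leftover V Q.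
  apply/leftoverP; split=> // i; have [_ HV _] := packingP _ _ pQz.
  by apply/negP => /(subsetP (HV i)); rewrite !inE eqxx.
have zadj x : x \in L :\: N -> z != x /\ adj z x.
  rewrite in_setD eN in_set => /andP[nx xL]; rewrite xL /= in nx.
  have zx : z != x by case/leftoverP: xL => /setD1P[]; rewrite eq_sym.
  by split=> //; apply: nonadjN.
have cM : #|L :\: N| = #|L| - #|N| by rewrite cardsDS.
(* The first side is made of k seagulls, the singleton z and these l - k - 1 singletons. Since |N| <
   t - 2k, L minus N has at least t - k - 1 vertices, enough for them and the t - l of the other
   side. *)
have [M1 sM1 cM1] : exists2 B : {set G}, B \subset L :\: N & #|B| = (l - k).-1.
  by apply: subset_of_card; rewrite cM; clear - cV cQ NL ltN kl lt tV; lia.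
have [XB sXB cXB] : exists2 B : {set G}, B \subset (L :\: N) :\: M1 & #|B| = t - l.
  by apply: subset_of_card; rewrite cardsDS // cM cM1; clear - cV cQ NL ltN kl lt tV; lia.
have zM : z \notin L :\: N by apply/negP => /zadj[]; rewrite eqxx.
have cXA : k + #|z |: M1| = l.
  rewrite cardsU1 (contra (subsetP sM1 z)) // cM1; clear - kl; lia.
rewrite -cXB -cXA; apply: (packing_branches pQ).
- by rewrite subUset sub1set zQ; apply/subsetP => x /(subsetP sM1) /setDP[/LL].
- by apply/subsetP => x /(subsetP sXB) /setDP[/setDP[/LL]].
- move=> x y; rewrite in_setU1 => /orP[/eqP->|xM] /(subsetP sXB) /setDP[yM yM1].
    by case: (zadj y yM).
  have xy : x != y by apply: contraNneq yM1 => <-.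
  (* T-adjacent x and y would form a further seagull with centre z. As [M1] is nonempty, k + 1 < l,
     which contradicts the choice of k. *)
  apply: nonadjN => //; apply/negP => nxy.
  have [_ zx] := zadj x (subsetP sM1 x xM); have [_ zy] := zadj y yM.
  have [] := packing_extend pQ (seagull3 nxy zx zy).
    rewrite !subUset !sub1set zQ andbT; apply/andP; split; apply: LL.
      by case/setDP: (subsetP sM1 x xM).
    by case/setDP: yM.
  move=> R pR; have : 0 < #|M1| by apply/card_gt0P; exists x.
  rewrite cM1 => kl1; have := maxk k.+1; rewrite ltnn => H.
  suff: false by []; apply: H; apply/andP; split; first by clear - kl1; lia.
  by apply/existsP; exists R.
Qed.

(** * The general case, by induction through Gallai's lemma *)

Lemma unpaired_setD1 V f x : x \in V -> pairing (V :\ x) f ->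
  #|unpaired V f| = #|unpaired (V :\ x) f|.+1.
Proof.
move=> xV pf; have fx : f x = x by apply: pairing_out pf _; rewrite !inE eqxx.
rewrite (cardsD1 x) inE xV fx eqxx add1n; congr _.+1.
by apply: eq_card => y; rewrite !inE andbA.
Qed.

Definition join_pairing V1 f1 f2 : {ffun G -> G} :=
  [ffun x => if x \in V1 then f1 x else f2 x].

Lemma pairing_join V1 V2 f1 f2 : [disjoint V1 & V2] ->
  pairing V1 f1 -> pairing V2 f2 -> pairing (V1 :|: V2) (join_pairing V1 f1 f2).
Proof.
move=> dis p1 p2; have [ff1 fe1] := pairingP _ _ p1; have [ff2 fe2] := pairingP _ _ p2.
have out2 x : x \notin V1 -> f2 x \notin V1.
  have [x2 _|x2] := boolP (x \in V2); last by rewrite (pairing_out p2).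
  by rewrite (disjointFl dis) ?(pairing_in p2).
apply/pairingP; split=> x; rewrite !ffunE.
  by case: (boolP (x \in V1)) => x1; [rewrite (pairing_in p1) | rewrite (negbTE (out2 _ x1))].
by rewrite !inE; case: ifPn => x1 => [/fe1[_ -> ->]|/fe2[-> -> ->]]; rewrite ?orbT.
Qed.

Lemma unpaired_join V1 V2 f1 f2 : [disjoint V1 & V2] ->
  #|unpaired (V1 :|: V2) (join_pairing V1 f1 f2)| <= #|unpaired V1 f1| + #|unpaired V2 f2|.
Proof.
move=> dis; apply: leq_trans (leq_card_setU _ _); apply: subset_leq_card.
apply/subsetP => x; rewrite !inE ffunE => /andP[].
by case: ifPn => [x1 _ ->//|x1 /= -> ->].
Qed.

(** The hypothesis stands in for t <= chi(G[V]): every pairing colours V with at least t colours.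
    Allowing any such t, not only the largest, lets the induction split t between the parts of a
    join. *)
Lemma branches_of_pairings V t : no_stable3 ->
  (forall f, pairing V f -> t.*2 <= #|V| + #|unpaired V f|) ->
  forall a b, a + b = t -> bipartite_branches V a b.
Proof.
move=> tri; have [n] := ubnP #|V|; elim: n V t => // n IH V t ltV cov a b abt.
have [t0|tpos] := posnP t.
  exists [::], [::]; do 2?split=> //; lia.
case: (boolP [exists x in V, [forall f, pairing (V :\ x) f ==>
          (t.*2 <= #|V :\ x| + #|unpaired (V :\ x) f|)]]).
  move=> /existsP[x /andP[xV /forallP H]].
  apply: bipartite_branchesS (subsetDl V [set x]) _; apply: (IH _ t) => //.
    by move: ltV; rewrite (cardsD1 x) xV; lia.
  by move=> f; apply/implyP.
move=> /existsPn H.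
have crit : {in V, forall u, exists2 f, optimal V f & f u = u}.
  (* A pairing f of V - u violating the bound misses u. As a pairing of V its sum of |V| and the
     unpaired count is even, at least 2t and below 2t + 2; so it equals 2t, and f is optimal. *)
  move=> u uV; have := H u; rewrite uV => /forallPn[f].
  rewrite negb_imply -ltnNge => /andP[pf lt].
  have pVf : pairing V f := pairingS (subsetDl _ _) pf.
  exists f; last by apply: pairing_out pf _; rewrite !inE eqxx.
  have [m e _] := pairing_parity pVf; apply/optimalP; split=> // g /cov.
  have := cov _ pVf; have := unpaired_setD1 uV pf; have := cardsD1 u V; rewrite uV.
  move: lt e; lia.
have [[f /optimalP[pf _] le1]|[V1 [sV1 V1n V2n ad]]] := gallai crit.
  have tV : t.*2 <= #|V|.+1 by have := cov _ pf; lia.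
  (* [branches_large] requires a positive smaller side; if one side is empty, singletons suffice for
     the other. *)
  have full m : m <= #|V| -> bipartite_branches V 0 m.
    move=> mV; have [X sX <-] := subset_of_card mV.
    have LV : leftover V [ffun _ : 'I_0 => set0] = V by rewrite /leftover big_ord0 setD0.
    have := packing_branches (XA := set0) (XB := X) (packing0 V [ffun=> set0]).
    rewrite cards0 LV; apply; rewrite ?sub0set //.
    by move=> x y; rewrite inE.
  case: (posnP a) => [a0|apos]; first by rewrite a0; apply: full; lia.
  case: (posnP b) => [b0|bpos]; first by rewrite b0; apply/bipartite_branchesC/full; lia.
  case: (leqP a b) => ab.
    have -> : b = t - a by lia.
    by apply: branches_large => //; lia.
  apply: bipartite_branchesC; have -> : a = t - b by lia.
  by apply: branches_large => //; lia.
pose V2 := V :\: V1.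
have dis : [disjoint V1 & V2].
  by rewrite disjoints_subset; apply/subsetP => x; rewrite !inE negb_and negbK => ->.
have eV : V1 :|: V2 = V by rewrite -[RHS](setID V V1) (setIidPr sV1).
have cV : #|V| = #|V1| + #|V2| by rewrite -eV cardsU (disjoint_setI0 dis) cards0 subn0.
rewrite -card_gt0 in V1n; rewrite -card_gt0 -/V2 in V2n.
have [f1 /optimalP[pf1 min1]] := optimal_exists V1.
have [f2 /optimalP[pf2 min2]] := optimal_exists V2.
have [m1 e1 _] := pairing_parity pf1; have [m2 e2 _] := pairing_parity pf2.
(* Optimal pairings of the two parts combine to a pairing of V with at most m1 + m2 colours. *)
have tm : t <= m1 + m2.
  have := cov (join_pairing V1 f1 f2); rewrite -{1}eV => /(_ (pairing_join dis pf1 pf2)).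
  by have := unpaired_join f1 f2 dis; rewrite eV; move: e1 e2; rewrite cV; clear; lia.
(* Greedy split: V1 takes as many of the t branch sets as its bound m1 allows, and as many of the
   first side as fit among these. *)
pose t1 := minn t m1; pose t2 := t - t1; pose a1 := minn a t1; pose a2 := a - a1.
have G1 : bipartite_branches V1 a1 (t1 - a1).
  apply: (IH V1 t1); first by move: ltV cV V2n; clear; lia.
    by move=> f /min1; move: e1; rewrite /t1; clear; lia.
  by rewrite /a1; clear; lia.
have G2 : bipartite_branches V2 a2 (t2 - a2).
  apply: (IH V2 t2); first by move: ltV cV V1n; clear; lia.
    by move=> f /min2; move: e2 tm; rewrite /t2 /t1; clear; lia.
  by move: abt; rewrite /a2 /t2 /a1 /t1; clear; lia.
have := bipartite_branches_join dis ad G1 G2; rewrite eV.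
have -> : a1 + a2 = a by rewrite /a2 /a1; clear; lia.
by have -> : t1 - a1 + (t2 - a2) = b by move: abt; rewrite /a2 /t2 /a1 /t1; clear; lia.
Qed.

(** * Translation from the independence and chromatic numbers *)

Lemma no_stable3_of_independence : independence_number G = 2 -> no_stable3.
Proof.
move=> alpha x y z xy yz; apply/negP => xz.
have st : stable [set x; y; z].
  apply/forallP => u; apply/implyP; rewrite !inE => hu.
  apply/forallP => v; apply/implyP; rewrite !inE => hv.
  have E p q : nonadj p q -> ~~ adj p q /\ ~~ adj q p.
    by rewrite [adj q p]adj_sym => /andP[].
  have [[? ?] [? ?] [? ?]] := And3 (E _ _ xy) (E _ _ yz) (E _ _ xz).
  by move: hu hv; rewrite -!orbA => /or3P[]/eqP-> /or3P[]/eqP->; rewrite ?adj_irrefl.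
have : #|[set x; y; z]| <= independence_number G by apply: leq_bigmax_cond st.
rewrite alpha -setUA cardsU1 cards2 !inE negb_or.
by rewrite (nonadj_neq xy) (nonadj_neq yz) (nonadj_neq xz).
Qed.

Lemma chromatic_le (c : G -> G) m : #|c @: [set: G]| <= m ->
  (forall x y, adj x y -> c x != c y) -> chromatic_number G <= m.
Proof.
move=> le cP; rewrite /chromatic_number; case: ex_minnP => k _; apply.
have im x : c x \in c @: [set: G] by apply: imset_f.
apply/existsP; exists [ffun x => widen_ord le (enum_rank_in (im x) (c x))].
apply/forallP => x; apply/forallP => y; apply/implyP => /cP; rewrite !ffunE.
apply: contraNneq => /(congr1 val) /= /val_inj /enum_rank_in_inj -> //.
Qed.

Lemma branches_of_chromatic a b : no_stable3 -> a + b = chromatic_number G ->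
  bipartite_branches [set: G] a b.
Proof.
move=> tri; apply: branches_of_pairings => // f /pairing_parity[m -> [c [le cP]]].
by rewrite leq_double; apply: chromatic_le le _ => x y; apply: cP.
Qed.

End Nonadjacency.

(** * Special odd models from lists of branch sets *)

Section BranchModel.

Variable G : sgraph.
Implicit Types (x y : G) (b : seq G).

(** Index 1 is the middle of a seagull list; on a singleton [onth] yields [None], so singletons have
    no centre. *)
Definition center b x : bool := onth b 1 == Some x.

(** Requiring the centre on every edge makes this a star for any list, so acyclicity holds whether
    or not b is a valid branch set. *)
Definition branch_edge b : rel G := fun x y =>
  [&& adj x y, x \in b, y \in b & center b x || center b y].

Lemma branch_edge_sym b : symmetric (branch_edge b).
Proof.
by move=> x y; rewrite /branch_edge adj_sym orbC; congr andb; rewrite andbCA.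
Qed.

Lemma branch_edge_adj b x y : branch_edge b x y -> adj x y.
Proof. by case/andP. Qed.

Lemma branch_edge_verts b x y : branch_edge b x y ->
  (x \in [set v in b]) && (y \in [set v in b]).
Proof. by rewrite !inE => /and4P[_ -> ->]. Qed.

Definition branch_subgraph b : subgraph G :=
  Subgraph (branch_edge_sym b) (@branch_edge_adj b) (@branch_edge_verts b).

Lemma center_inj b x y : center b x -> center b y -> x = y.
Proof. by rewrite /center => /eqP-> /eqP[]. Qed.

Lemma center_mem b x : center b x -> x \in b.
Proof. by case: b => [|a [|c b]] // /eqP[<-]; rewrite !inE eqxx orbT. Qed.

(* Every edge contains the centre, which a cycle visits only once. *)
Lemma branch_edge_acyclic b (c : seq G) : uniq c -> 2 < size c ->
  ~~ cycle (branch_edge b) c.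
Proof.
case: c => [|x [|y [|z c]]] // un _; apply/negP.
rewrite /cycle rcons_path /= => /andP[/and3P[xy yz _] lx].
have lc : last z c \in z :: c := mem_last z c.
set l := last z c in lc lx.
have [xl yl] : x != l /\ y != l.
  move: un => /= /and3P[]; rewrite in_cons negb_or => /andP[_ nx] ny _.
  by split; apply: contraTneq lc => <-.
have [nxy nxz nyz] : [/\ x != y, x != z & y != z].
  move: un => /= /and3P[]; rewrite !in_cons !negb_or => /and3P[-> -> _] /andP[-> _] _.
  by [].
case/and4P: xy => _ _ _ /orP[cx|cy].
  case/and4P: yz => _ _ _ /orP[c'|c']; have e := center_inj cx c'.
    by rewrite e eqxx in nxy.
  by rewrite e eqxx in nxz.
case/and4P: lx => _ _ _ /orP[c'|c']; have e := center_inj cy c'.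
  by rewrite e eqxx in yl.
by rewrite e eqxx in nxy.
Qed.

Lemma branch_tree b : branch b -> is_tree (branch_subgraph b).
Proof.
move=> br; split; last exact: branch_edge_acyclic.
  by case: b br => [|x b] // _; apply/set0Pn; exists x; rewrite !inE eqxx.
case: b br => [|u [|w [|v [|? ?]]]] //=.
  by move=> _ x y; rewrite !inE => /eqP-> /eqP->; apply: connect0.
case/and3P=> uw wv _.
have csym := sym_connect_sym (branch_edge_sym [:: u; w; v]).
suff H x : x \in [set t in [:: u; w; v]] -> connect (branch_edge [:: u; w; v]) w x.
  by move=> x y xb yb; apply: connect_trans (H y yb); rewrite csym; apply: H.
rewrite !inE => /or3P[]/eqP->; rewrite ?connect0 //; apply: connect1;
  rewrite /branch_edge /center /= !inE !eqxx ?orbT /= ?andbT //.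
by rewrite adj_sym.
Qed.

Lemma branch_noncenter b : branch b -> exists2 x, x \in b & ~~ center b x.
Proof.
case: b => [|u b] // br; exists u; first exact: mem_head.
case: b br => [|w [|v [|? ?]]] //= /and3P[uw _ _].
by rewrite /center /=; apply: contraTneq uw => -[->]; rewrite adj_irrefl.
Qed.

Lemma seagull_noncenter_adj b y : no_stable3 G -> branch b -> size b = 3 ->
  y \notin b -> exists x, [/\ x \in b, ~~ center b x & adj x y].
Proof.
move=> tri; case: b => [|u [|w [|v [|? ?]]]] //= /and3P[uw wv uv] _.
rewrite !inE !negb_or => /and3P[yu yw yv].
have [nuy|uy] := boolP (nonadj u y); last first.
  exists u; rewrite mem_head nonadjN // 1?eq_sym //; split=> //.
  by rewrite /center /=; apply: contraTneq uw => -[->]; rewrite adj_irrefl.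
exists v; rewrite !inE eqxx !orbT nonadjN // 1?eq_sym //; last first.
  by rewrite nonadjC; apply: tri uv; rewrite nonadjC.
split=> //; rewrite /center /=.
by apply: contraTneq wv => -[->]; rewrite adj_irrefl.
Qed.

Lemma flatten_uniq_nth (ss : seq (seq G)) i j x : uniq (flatten ss) ->
  x \in nth [::] ss i -> x \in nth [::] ss j -> i = j.
Proof.
have F s k : x \in nth [::] s k -> x \in flatten s.
  move=> xk; apply/flattenP; exists (nth [::] s k) => //; apply: mem_nth.
  by apply: contraLR xk; rewrite -leqNgt => /(nth_default [::]) ->.
elim: ss i j => [|s ss IH] [|i] [|j] //=; rewrite cat_uniq => /and3P[us /hasPn ns uss].
- by move=> xs /F /ns; rewrite xs.
- by move=> /F /ns /= /negP.
- by move=> xi xj; rewrite (IH i j).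
Qed.

End BranchModel.

Lemma special_odd_model_of_branches (G : sgraph) a b : no_stable3 G ->
  bipartite_branches [set: G] a b ->
  has_special_odd_model (complete_bipartite a b) G.
Proof.
move=> tri [sA [sB [[lA lB br] [un _ ad]]]].
pose ss := sA ++ sB.
(* The second side starts at position [size sA], which may exceed a; surplus lists are ignored. *)
pose idx (v : complete_bipartite a b) : nat :=
  match v with inl i => i | inr j => size sA + j end.
have idx_lt v : idx v < size ss.
  rewrite size_cat; case: v => i /=.
    by apply/ltn_addr/(leq_trans (ltn_ord i)).
  by rewrite ltn_add2l (leq_trans (ltn_ord i)).
have idx_inj u v : idx u = idx v -> u = v.
  case: u v => [i|i] [j|j] /= e.
  - by congr inl; apply: val_inj.
  - by have := ltn_ord i; have := leq_addr j (size sA); rewrite -e; lia.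
  - by have := ltn_ord j; have := leq_addr i (size sA); rewrite e; lia.
  - by congr inr; apply/val_inj/(addnI e).
pose B v := nth [::] ss (idx v).
have Bss v : B v \in ss by apply: mem_nth.
have Bbr v : branch (B v) := allP br _ (Bss v).
(* Blue is [true] and marks exactly the seagull centres; ends and singletons are red. *)
pose c x := has (fun s => center s x) ss.
have cE s x : s \in ss -> x \in s -> c x = center s x.
  move=> sss xs; apply/hasP/idP => [[s' s's cx]|]; last by exists s.
  suff -> : s = s' by [].
  have xs' := center_mem cx.
  rewrite -(nth_index [::] sss) -(nth_index [::] s's); congr nth.
  by apply: (@flatten_uniq_nth _ _ _ _ x un); rewrite nth_index.
have same u v : u != v -> adj u v ->
  exists x y, [/\ x \in B u, y \in B v, adj x y & c x = c y].
  (* By symmetry either [B u] is a seagull, one of whose ends is adjacent to any chosen red vertex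
     of [B v], or both are singletons and [ad] applies. *)
  wlog : u v / size (B u) = 3 \/ size (B u) = 1 /\ size (B v) = 1 => [H nuv uv|].
    have sz w : size (B w) = 3 \/ size (B w) = 1.
      by move: (Bbr w); case: (B w) => [|? [|? [|? [|? ?]]]] //; auto.
    case: (sz u) => su; first by apply: H => //; left.
    case: (sz v) => sv; last by apply: H => //; right.
    have [||x [y [xv yu xy cxy]]] := H v u (or_introl sv); first by rewrite eq_sym.
      by rewrite adj_sym.
    by exists y, x; rewrite adj_sym cxy.
  move=> H nuv uv; case: H => [su|[su sv]].
    have [y yv cy] := branch_noncenter (Bbr v).
    have yu : y \notin B u.
      by apply: contra nuv => yu; apply/eqP/idx_inj/(flatten_uniq_nth un yu yv).
    have [x [xu cx xy]] := seagull_noncenter_adj tri (Bbr u) su yu.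
    exists x, y; split=> //.
    by rewrite (cE _ _ (Bss u) xu) (cE _ _ (Bss v) yv) (negbTE cx) (negbTE cy).
  have [x ex] : exists x, B u = [:: x] by case: (B u) su => [|x []] // _; exists x.
  have [y ey] : exists y, B v = [:: y] by case: (B v) sv => [|y []] // _; exists y.
  exists x, y; rewrite ex ey !mem_head; split=> //.
    have sAn i : i < size sA -> nth [::] ss i \in sA.
      by move=> lt; rewrite nth_cat lt mem_nth.
    have sBn (j : 'I_b) : nth [::] ss (size sA + j) \in sB.
      by rewrite nth_cat ltnNge leq_addr /= addKn mem_nth // (leq_trans (ltn_ord j)).
    move: ex ey; rewrite /B; case: u v uv {nuv su sv} => [i|i] [j|j] //= _ ex ey.
      by apply: ad; rewrite -?ex -?ey ?sBn ?sAn // (leq_trans (ltn_ord i)).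
    by rewrite adj_sym; apply: ad; rewrite -?ex -?ey ?sBn ?sAn // (leq_trans (ltn_ord j)).
  have xu : x \in B u by rewrite ex mem_head.
  have yv : y \in B v by rewrite ey mem_head.
  by rewrite (cE _ _ (Bss u) xu) (cE _ _ (Bss v) yv) ex ey.
exists (fun v => branch_subgraph (B v)).
split; last (exists c; split; first split).
- split=> [v|u v nuv|u v uv].
  + exact: branch_tree.
  + rewrite -setI_eq0; apply/eqP/setP => x; rewrite !inE.
    apply: contraNF nuv => /andP[xu xv]; apply/eqP/idx_inj.
    exact: flatten_uniq_nth un xu xv.
  + have nuv : u != v by apply: contraTneq uv => ->; rewrite adj_irrefl.
    by have [x [y [xu yv xy _]]] := same u v nuv uv; exists x, y; rewrite !inE.
- move=> v x y /= /and4P[xy xv yv cxy].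
  rewrite (cE _ _ (Bss v) xv) (cE _ _ (Bss v) yv).
  apply: contraTneq cxy => e; rewrite e orbb; apply/negP => cy.
  by have := adj_neq xy; rewrite (center_inj cy (_ : center (B v) x)) ?eqxx // e.
- move=> u v uv.
  have nuv : u != v by apply: contraTneq uv => ->; rewrite adj_irrefl.
  by have [x [y [xu yv xy cc]]] := same u v nuv uv; exists x, y; rewrite !inE.
- have S v x : sverts (branch_subgraph (B v)) = [set x] -> c x = false.
    move=> /= e; have xv : x \in B v by move/setP/(_ x): e; rewrite !inE eqxx.
    rewrite (cE _ _ (Bss v) xv).
    move: (Bbr v) e xv; case: (B v) => [|p [|q [|r [|? ?]]]] //=.
    move=> /and3P[pq _ _] e _; have : p \in [set x] by rewrite -e !inE eqxx.
    have : q \in [set x] by rewrite -e !inE eqxx orbT.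
    by rewrite !inE => /eqP eq /eqP ep; have := adj_neq pq; rewrite eq ep eqxx.
  by move=> u v x y /S -> /S ->.
Qed.

Theorem theorem2p7 (n : nat) (G : sgraph) (cardG : #|G| = n)
    (alphaG : independence_number G = 2) (l : nat) (l_gt0 : 0 < l)
    (l_lt_chi : l < chromatic_number G) :
  has_special_odd_model (complete_bipartite l (chromatic_number G - l)) G.
Proof.
have tri := no_stable3_of_independence alphaG.
apply: special_odd_model_of_branches (tri) _; apply: branches_of_chromatic tri _.
by rewrite subnKC // ltnW.
Qed.
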